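(* For all $x\in[0,\pi_{6/5,3}/4)$, $$\sin_{6/5,3}(2x)=\frac{4\cos_{6/5,3}^{1/5}x\,\bigl(1+3\cos_{6/5,3}^{3/5}x\bigr)\bigl(1-\cos_{6/5,3}^{3/5}x\bigr)^{1/3}}{\bigl(1+24\cos_{6/5,3}^{3/5}x+18\cos_{6/5,3}^{6/5}x-27\cos_{6/5,3}^{12/5}x\bigr)^{2/3}}.$$
   Context: For $p,q>1$, let $\pi_{p,q}=2\int_0^1\frac{dt}{(1-t^q)^{1/p}}<\infty$, let $\sin_{p,q}:[0,\pi_{p,q}/2)\to[0,1)$ be the inverse function of $y\mapsto\int_0^y \frac{dt}{(1-t^q)^{1/p}}$, $y\in[0,1)$, and let $\cos_{p,q}x=\frac{d}{dx}\sin_{p,q}x$ (one-sided derivative at $x=0$). The notation $\cos_{p,q}^a x$ means $(\cos_{p,q}x)^a$. *)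

(* Defs.v *)
From Stdlib Require Import Reals.
From Coquelicot Require Import Coquelicot.
Open Scope R_scope.

(* Real power x^a for a base x >= 0 and an exponent a > 0.  Stdlib's
   [Rpower 0 a] equals 1, whereas 0^a = 0 is needed here, for instance in
   (1 - t^q) at t = 0.  Negative bases get the junk value 0. *)
Definition rpow (x a : R) : R :=
  if Rle_dec x 0 then 0 else Rpower x a.

Definition pq_integrand (p q t : R) : R :=
  / rpow (1 - rpow t q) (1 / p).

(* The integrand is unbounded near 1: the integral is improper at 1. *)
Definition pi_pq (p q : R) : R :=
  2 * RInt_gen (pq_integrand p q) (at_point 0) (at_left 1).

Definition arcsin_pq (p q y : R) : R :=
  RInt (pq_integrand p q) 0 y.

(* [iota] selects the unique preimage of x in [0,1).  It exists for
   0 <= x < pi_pq p q / 2; outside that interval the value is unspecified. *)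
Definition sin_pq (p q x : R) : R :=
  iota (fun y : R => 0 <= y < 1 /\ arcsin_pq p q y = x).

(* As sin_pq is only meaningful on [0, pi_pq / 2), its derivative at 0 is the
   right derivative. *)
Definition cos_pq (p q x : R) : R :=
  if Req_EM_T x 0
  then iota (fun l : R =>
         filterlim (fun h : R => (sin_pq p q h - sin_pq p q 0) / h)
                   (at_right 0) (locally l))
  else Derive (sin_pq p q) x.

(* Main.v *)
(* Put u = cos(x)^(3/5), so that sin(x) = (1 - u^2)^(1/3), and let F(u) be the
   right-hand side of the formula.  Writing D = 1 + 24u + 18u^2 - 27u^4, one
   finds 1 - F^3 = ((3u - 1)^3 (1 + u) / D)^2, which makes the derivative of
   arcsin(F(u)) rational up to cube roots and equal to that of
   2 arcsin((1 - u^2)^(1/3)) on (1/3, 1).  Both functions vanish at u = 1, so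
   they agree; letting u tend to 1/3, where F = 1, shows that u = 1/3
   corresponds to x = pi/4. *)

Require Import Defs.
From Stdlib Require Import Reals Lra Ranalysis5.
From Coquelicot Require Import Coquelicot.
Open Scope R_scope.

(** * Real powers with the convention that nonpositive bases give 0 *)

Lemma rpow_pos_base (x a : R) : 0 < x -> rpow x a = Rpower x a.
Proof. intros Hx; unfold rpow; destruct (Rle_dec x 0); lra. Qed.

Lemma rpow_nonpos_base (x a : R) : x <= 0 -> rpow x a = 0.
Proof. intros Hx; unfold rpow; destruct (Rle_dec x 0); lra. Qed.

Lemma rpow_gt_0 (x a : R) : 0 < x -> 0 < rpow x a.
Proof. intros Hx; rewrite rpow_pos_base by exact Hx; apply exp_pos. Qed.

Lemma rpow_ge_0 (x a : R) : 0 <= rpow x a.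
Proof.
  destruct (Rle_dec x 0) as [Hx | Hx].
  - rewrite rpow_nonpos_base; lra.
  - apply Rlt_le, rpow_gt_0; lra.
Qed.

Lemma rpow_mult (x a b : R) : rpow (rpow x a) b = rpow x (a * b).
Proof.
  destruct (Rle_dec x 0) as [Hx | Hx].
  - rewrite !(rpow_nonpos_base x) by exact Hx; apply rpow_nonpos_base; lra.
  - rewrite (rpow_pos_base (rpow x a)) by (apply rpow_gt_0; lra).
    rewrite !(rpow_pos_base x) by lra; apply Rpower_mult.
Qed.

Lemma rpow_pow (x : R) (n : nat) : 0 <= x -> rpow x (INR (S n)) = x ^ S n.
Proof.
  intros [Hx | <-].
  - rewrite rpow_pos_base by exact Hx; apply Rpower_pow, Hx.
  - rewrite rpow_nonpos_base by lra; simpl; ring.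
Qed.

Lemma rpow_mult_pow (x a : R) (n : nat) :
  rpow x (INR (S n) * a) = rpow x a ^ S n.
Proof.
  rewrite <- (rpow_pow (rpow x a)) by apply rpow_ge_0.
  rewrite rpow_mult; f_equal; ring.
Qed.

Lemma rpow_mult_base (x y a : R) :
  0 <= x -> 0 <= y -> rpow (x * y) a = rpow x a * rpow y a.
Proof.
  intros [Hx | <-] [Hy | <-];
    try (rewrite ?Rmult_0_l, ?Rmult_0_r, !(rpow_nonpos_base 0) by lra; ring).
  rewrite !rpow_pos_base by (try apply Rmult_lt_0_compat; assumption).
  symmetry; apply Rpower_mult_distr; assumption.
Qed.

Lemma rpow_lt_1 (x a : R) : 0 < a -> x < 1 -> rpow x a < 1.
Proof.
  intros Ha Hx; destruct (Rle_dec x 0) as [H0 | H0].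
  - rewrite rpow_nonpos_base; lra.
  - rewrite rpow_pos_base by lra.
    replace 1 with (Rpower 1 a)
      by (unfold Rpower; rewrite ln_1, Rmult_0_r; apply exp_0).
    apply Rlt_Rpower_l; lra.
Qed.

Lemma is_derive_rpow (a x : R) :
  0 < x -> is_derive (fun t => rpow t a) x (a * rpow x a / x).
Proof.
  intros Hx.
  apply (is_derive_ext_loc (fun t => Rpower t a)).
  - exists (mkposreal x Hx); intros t Ht.
    symmetry; apply rpow_pos_base.
    change (Rabs (t - x) < x) in Ht; apply Rabs_def2 in Ht; lra.
  - rewrite rpow_pos_base by exact Hx.
    replace (a * Rpower x a / x) with (a * Rpower x (a - 1)).
    + apply is_derive_Reals, derivable_pt_lim_power, Hx.
    + replace (a - 1) with (a + Ropp 1) by ring.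
      rewrite Rpower_plus, Rpower_Ropp, Rpower_1 by exact Hx.
      field; lra.
Qed.

(** Left of 0 the function is locally zero and right of 0 it is differentiable. Only the gluing
    point 0 needs a direct estimate, and there a > 0 matters. *)
Lemma continuous_rpow (a x : R) : 0 < a -> continuous (fun t => rpow t a) x.
Proof.
  intros Ha; destruct (Rtotal_order x 0) as [Hx | [-> | Hx]].
  - apply (continuous_ext_loc _ (fun _ => 0)); [ | apply continuous_const].
    exists (mkposreal (- x) ltac:(lra)); intros t Ht.
    symmetry; apply rpow_nonpos_base.
    change (Rabs (t - x) < - x) in Ht; apply Rabs_def2 in Ht; lra.
  - apply continuity_pt_filterlim; intros eps Heps.
    (* For 0 < t < eps^(1/a), monotonicity of the power gives t^a < eps. *)
    exists (Rpower eps (/ a)); split; [apply exp_pos | ].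
    intros t [_ Ht]; change (Rabs (t - 0) < Rpower eps (/ a)) in Ht.
    change (Rabs (rpow t a - rpow 0 a) < eps).
    rewrite (rpow_nonpos_base 0), Rminus_0_r, Rabs_pos_eq
      by (try apply rpow_ge_0; lra).
    destruct (Rle_dec t 0) as [H0 | H0].
    + rewrite rpow_nonpos_base; lra.
    + rewrite Rminus_0_r, Rabs_pos_eq in Ht by lra.
      rewrite rpow_pos_base by lra.
      replace eps with (Rpower (Rpower eps (/ a)) a).
      * apply Rlt_Rpower_l; lra.
      * rewrite Rpower_mult, Rinv_l, Rpower_1; lra.
  - apply (ex_derive_continuous (fun t : R => rpow t a)).
    eexists; apply is_derive_rpow, Hx.
Qed.

(** * The integral [arcsin_pq]: smoothness, growth and injectivity *)

Lemma pq_integrand_ge_1 (p q t : R) :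
  0 < p -> 0 < q -> t < 1 -> 1 <= pq_integrand p q t.
Proof.
  intros Hp Hq Ht; unfold pq_integrand.
  pose proof (rpow_lt_1 t q Hq Ht); pose proof (rpow_ge_0 t q) as [H0 | H0].
  - pose proof (rpow_gt_0 (1 - rpow t q) (1 / p) ltac:(lra)).
    rewrite <- Rinv_1 at 1; apply Rinv_le_contravar; [assumption | ].
    apply Rlt_le, rpow_lt_1; [ | lra].
    apply Rdiv_lt_0_compat; lra.
  - rewrite <- H0, Rminus_0_r, rpow_pos_base by lra.
    unfold Rpower; rewrite ln_1, Rmult_0_r, exp_0; lra.
Qed.

Lemma continuous_pq_integrand (p q t : R) :
  0 < p -> 0 < q -> t < 1 -> continuous (pq_integrand p q) t.
Proof.
  intros Hp Hq Ht; pose proof (rpow_lt_1 t q Hq Ht).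
  apply (continuous_Rinv_comp (fun t => rpow (1 - rpow t q) (1 / p))).
  - apply (continuous_comp (fun t => 1 - rpow t q) (fun v => rpow v (1 / p))).
    + apply (continuous_minus (fun _ : R => 1) (fun t : R => rpow t q)).
      * apply continuous_const.
      * apply continuous_rpow, Hq.
    + apply continuous_rpow, Rdiv_lt_0_compat; lra.
  - apply Rgt_not_eq, rpow_gt_0; lra.
Qed.

Lemma is_RInt_pq_integrand (p q y : R) :
  0 < p -> 0 < q -> y < 1 ->
  is_RInt (pq_integrand p q) 0 y (arcsin_pq p q y).
Proof.
  intros Hp Hq Hy.
  apply (RInt_correct (V := R_CompleteNormedModule)).
  apply (ex_RInt_continuous (V := R_CompleteNormedModule)).
  intros z [_ Hz]; apply continuous_pq_integrand; try assumption.
  apply Rle_lt_trans with (1 := Hz), Rmax_lub_lt; lra.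
Qed.

Lemma is_derive_arcsin_pq (p q y : R) :
  0 < p -> 0 < q -> y < 1 ->
  is_derive (arcsin_pq p q) y (pq_integrand p q y).
Proof.
  intros Hp Hq Hy.
  apply (is_derive_RInt (pq_integrand p q) (arcsin_pq p q) 0).
  - exists (mkposreal (1 - y) ltac:(lra)); intros z Hz.
    apply is_RInt_pq_integrand; try assumption.
    change (Rabs (z - y) < 1 - y) in Hz; apply Rabs_def2 in Hz; lra.
  - apply continuous_pq_integrand; assumption.
Qed.

Lemma continuous_arcsin_pq (p q y : R) :
  0 < p -> 0 < q -> y < 1 -> continuous (arcsin_pq p q) y.
Proof.
  intros Hp Hq Hy; apply (ex_derive_continuous (arcsin_pq p q)).
  eexists; apply is_derive_arcsin_pq; assumption.
Qed.

(** Mean value theorem with a derivative at least 1. This one estimate supplies monotonicity,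
    injectivity, and later the continuity of the inverse. *)
Lemma arcsin_pq_expanding (p q y z : R) :
  0 < p -> 0 < q -> y <= z -> z < 1 ->
  z - y <= arcsin_pq p q z - arcsin_pq p q y.
Proof.
  intros Hp Hq Hyz Hz.
  destruct (MVT_gen (arcsin_pq p q) y z (pq_integrand p q)) as [c [Hc ->]];
    rewrite ?Rmin_left, ?Rmax_right in * by assumption.
  - intros t Ht; apply is_derive_arcsin_pq; lra.
  - intros t Ht; apply continuity_pt_filterlim.
    apply continuous_arcsin_pq; lra.
  - rewrite <- (Rmult_1_l (z - y)) at 1; apply Rmult_le_compat_r; [lra | ].
    apply pq_integrand_ge_1; lra.
Qed.

Lemma arcsin_pq_inj (p q y z : R) :
  0 < p -> 0 < q -> y < 1 -> z < 1 ->
  arcsin_pq p q y = arcsin_pq p q z -> y = z.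
Proof.
  intros Hp Hq Hy Hz E; destruct (Rle_dec y z) as [H | H].
  - pose proof (arcsin_pq_expanding p q y z Hp Hq H Hz); lra.
  - pose proof (arcsin_pq_expanding p q z y Hp Hq ltac:(lra) Hy); lra.
Qed.

(** The default value of [rpow] makes the integrand equal to 1 at negative t, so the integral
    continues as the identity left of 0. *)
Lemma arcsin_pq_nonpos (p q y : R) : 0 < p -> y <= 0 -> arcsin_pq p q y = y.
Proof.
  intros Hp Hy; unfold arcsin_pq.
  rewrite (RInt_ext _ (fun _ => 1)).
  - rewrite RInt_const; change (scal (y - 0) 1) with ((y - 0) * 1); ring.
  - intros t; rewrite Rmin_right, Rmax_left by exact Hy; intros Ht.
    unfold pq_integrand; rewrite (rpow_nonpos_base t) by lra.
    rewrite rpow_pos_base by lra.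
    unfold Rpower; rewrite Rminus_0_r, ln_1, Rmult_0_r, exp_0; apply Rinv_1.
Qed.

(** * Inverting [arcsin_pq], and the derivative of the inverse *)

Lemma sin_pq_arcsin_pq (p q y : R) :
  0 < p -> 0 < q -> 0 <= y < 1 -> sin_pq p q (arcsin_pq p q y) = y.
Proof.
  intros Hp Hq Hy; unfold sin_pq; apply (iota_unique (V := R_CompleteNormedModule)).
  - intros z [Hz E]; apply (arcsin_pq_inj p q); try assumption; lra.
  - split; [exact Hy | reflexivity].
Qed.

(** With k = s(x + h) - s(x), the difference quotient k / h of s is the inverse of the quotient h /
    k of f. Continuity of s makes k small, and inversion is continuous at l. *)
Lemma is_derive_right_inverse (f s : R -> R) (x l : R) :
  l <> 0 ->
  continuous s x ->
  locally x (fun t => f (s t) = t) ->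
  is_derive f (s x) l ->
  is_derive s x (/ l).
Proof.
  intros Hl Hs Hfs Hf.
  pose proof (locally_singleton _ _ Hfs) as Hx; cbv beta in Hx.
  apply is_derive_Reals in Hf.
  apply is_derive_Reals; intros eps Heps.
  assert (Hinv : continuous Rinv l)
    by (apply (continuous_Rinv_comp (fun v => v));
        [apply continuous_id | exact Hl]).
  destruct (proj1 (filterlim_locally _ _) Hinv (mkposreal eps Heps))
    as [eta Heta].
  destruct (Hf eta (cond_pos eta)) as [del Hdel].
  destruct (filter_and _ _ Hfs (proj1 (filterlim_locally _ _) Hs del))
    as [d Hd].
  exists d; intros h Hh0 Hh.
  destruct (Hd (x + h)) as [E Hk].
  { change (Rabs (x + h - x) < d); replace (x + h - x) with h by ring.
    exact Hh. }
  change (Rabs (s (x + h) - s x) < del) in Hk.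
  set (k := s (x + h) - s x) in *.
  assert (Ek : s x + k = s (x + h)) by (unfold k; ring).
  (* A right inverse is injective: k = 0 would force x + h = x. *)
  assert (Hk0 : k <> 0).
  { intros Hk0; apply Hh0; rewrite Hk0, Rplus_0_r in Ek.
    rewrite Ek in Hx; lra. }
  specialize (Hdel k Hk0 Hk); rewrite Ek, E, Hx in Hdel.
  replace (x + h - x) with h in Hdel by ring.
  replace (k / h) with (/ (h / k)) by (field; split; assumption).
  apply (Heta (h / k)); exact Hdel.
Qed.

(* [sin_pq] is unspecified at negative arguments; continuing it there by the
   identity inverts [arcsin_pq] on both sides of 0, so that the two cases of
   [cos_pq] are instances of one two-sided derivative. *)
Definition sin_pq_ext (p q x : R) : R :=
  if Rle_dec x 0 then x else sin_pq p q x.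

Lemma sin_pq_ext_arcsin_pq (p q y : R) :
  0 < p -> 0 < q -> y < 1 -> sin_pq_ext p q (arcsin_pq p q y) = y.
Proof.
  intros Hp Hq Hy; unfold sin_pq_ext.
  destruct (Rle_dec y 0) as [H | H].
  - rewrite arcsin_pq_nonpos by assumption.
    destruct (Rle_dec y 0); [reflexivity | contradiction].
  - pose proof (arcsin_pq_expanding p q 0 y Hp Hq ltac:(lra) Hy) as E.
    rewrite (arcsin_pq_nonpos p q 0) in E by lra.
    destruct (Rle_dec (arcsin_pq p q y) 0); [lra | ].
    apply sin_pq_arcsin_pq; lra.
Qed.

Lemma is_derive_sin_pq_ext (p q y : R) :
  0 < p -> 0 < q -> y < 1 ->
  is_derive (sin_pq_ext p q) (arcsin_pq p q y) (/ pq_integrand p q y).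
Proof.
  intros Hp Hq Hy.
  (* The two points are y - (1 - y)/2 and y + (1 - y)/2, both below 1. By expansion their images lie
     at least (1 - y)/2 away from [arcsin_pq p q y], so the intermediate value theorem covers a ball
     of that radius. *)
  pose proof (arcsin_pq_expanding p q ((3 * y - 1) / 2) y
    Hp Hq ltac:(lra) Hy) as E1.
  pose proof (arcsin_pq_expanding p q y ((y + 1) / 2)
    Hp Hq ltac:(lra) ltac:(lra)) as E2.
  assert (Hloc : locally (arcsin_pq p q y)
    (fun t => exists z, z < 1 /\ arcsin_pq p q z = t)).
  { exists (mkposreal ((1 - y) / 2) ltac:(lra)); intros t Ht.
    change (Rabs (t - arcsin_pq p q y) < (1 - y) / 2) in Ht.
    apply Rabs_def2 in Ht.
    destruct (f_interv_is_interv (arcsin_pq p q)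
      ((3 * y - 1) / 2) ((y + 1) / 2) t) as [z [Hz Ez]]; try lra.
    - intros z Hz; apply continuity_pt_filterlim.
      apply continuous_arcsin_pq; lra.
    - exists z; split; [lra | exact Ez]. }
  apply (is_derive_right_inverse (arcsin_pq p q)).
  - pose proof (pq_integrand_ge_1 p q y Hp Hq Hy); lra.
  (* The inverse of an expanding map is 1-Lipschitz, so delta = eps works. *)
  - unfold continuous; rewrite sin_pq_ext_arcsin_pq by assumption.
    apply filterlim_locally; intros eps.
    apply (filter_imp _ _) with
      (2 := filter_and _ _ Hloc (locally_ball (arcsin_pq p q y) eps)).
    intros t [[z [Hz <-]] Ht]; rewrite sin_pq_ext_arcsin_pq by assumption.
    change (Rabs (arcsin_pq p q z - arcsin_pq p q y) < eps) in Ht.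
    change (Rabs (z - y) < eps).
    apply Rabs_def2 in Ht; apply Rabs_def1;
      destruct (Rle_dec y z) as [H | H].
    + pose proof (arcsin_pq_expanding p q y z Hp Hq H Hz); lra.
    + pose proof (cond_pos eps); lra.
    + pose proof (cond_pos eps); lra.
    + pose proof (arcsin_pq_expanding p q z y Hp Hq ltac:(lra) Hy); lra.
  - apply (filter_imp _ _) with (2 := Hloc); intros t [z [Hz <-]].
    rewrite sin_pq_ext_arcsin_pq by assumption; reflexivity.
  - rewrite sin_pq_ext_arcsin_pq by assumption.
    apply is_derive_arcsin_pq; assumption.
Qed.

(** The derivative of the inverse is the reciprocal of the integrand, which is itself a
    reciprocal. *)
Lemma cos_pq_arcsin_pq (p q y : R) :
  0 < p -> 0 < q -> 0 <= y < 1 ->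
  cos_pq p q (arcsin_pq p q y) = rpow (1 - rpow y q) (1 / p).
Proof.
  intros Hp Hq Hy.
  pose proof (is_derive_sin_pq_ext p q y Hp Hq (proj2 Hy)) as Hd.
  unfold pq_integrand in Hd; rewrite Rinv_inv in Hd.
  set (c := rpow (1 - rpow y q) (1 / p)) in *.
  pose proof (arcsin_pq_expanding p q 0 y Hp Hq ltac:(lra) ltac:(lra)) as E.
  rewrite (arcsin_pq_nonpos p q 0) in E by lra.
  unfold cos_pq; destruct (Req_EM_T (arcsin_pq p q y) 0) as [E0 | E0].
  (* At 0 the two-sided derivative of the extension is restricted to h > 0, where the extension
     agrees with [sin_pq]. *)
  - rewrite E0 in Hd.
    assert (Hlim : filterlim (fun h => (sin_pq p q h - sin_pq p q 0) / h)
              (at_right 0) (locally c)).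
    { assert (S0 : sin_pq p q 0 = 0).
      { rewrite <- (arcsin_pq_nonpos p q 0) at 1 by lra.
        apply sin_pq_arcsin_pq; lra. }
      rewrite S0; apply filterlim_locally; intros eps.
      apply is_derive_Reals in Hd.
      destruct (Hd eps (cond_pos eps)) as [del Hdel].
      exists del; intros h Hh Hh0.
      change (Rabs (h - 0) < del) in Hh; rewrite Rminus_0_r in Hh.
      specialize (Hdel h ltac:(lra) Hh); unfold sin_pq_ext in Hdel.
      rewrite Rplus_0_l in Hdel.
      destruct (Rle_dec h 0); [lra | ].
      destruct (Rle_dec 0 0); [exact Hdel | lra]. }
    apply (iota_unique (V := R_CompleteNormedModule)); [ | exact Hlim].
    intros l Hl; apply (filterlim_locally_unique (F := at_right 0)
      (fun h => (sin_pq p q h - sin_pq p q 0) / h)); assumption.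
  - apply is_derive_unique.
    apply (is_derive_ext_loc (sin_pq_ext p q)); [ | exact Hd].
    assert (Hpos : 0 < arcsin_pq p q y) by lra.
    (* This radius keeps t positive, away from the identity branch of the extension. *)
    exists (mkposreal _ Hpos); intros t Ht.
    change (Rabs (t - arcsin_pq p q y) < arcsin_pq p q y) in Ht.
    apply Rabs_def2 in Ht; unfold sin_pq_ext.
    destruct (Rle_dec t 0); [lra | reflexivity].
Qed.

(** The partial integrals increase with the upper endpoint, so the improper integral is their
    supremum. Convergence thus needs no separate argument. *)
Lemma pi_pq_sup (p q L : R) :
  0 < p -> 0 < q ->
  (forall y, 0 <= y < 1 -> arcsin_pq p q y <= L) ->
  (forall eps : posreal, exists y, 0 <= y < 1 /\ L - eps < arcsin_pq p q y) ->
  pi_pq p q = 2 * L.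
Proof.
  intros Hp Hq Hle Hge; unfold pi_pq; f_equal.
  apply is_RInt_gen_unique.
  intros P [eps HP]; destruct (Hge eps) as [a [Ha HLa]].
  (* The lower endpoint is exactly 0. For an upper endpoint in [a, 1), monotonicity confines the
     integral to (L - eps, L]. *)
  apply (Filter_prod _ _ _ (fun x => x = 0) (fun z => a <= z < 1)).
  - reflexivity.
  - exists (mkposreal (1 - a) ltac:(lra)); intros z Hz Hz1.
    change (Rabs (z - 1) < 1 - a) in Hz; apply Rabs_def2 in Hz; lra.
  - intros x z -> Hz; exists (arcsin_pq p q z); split.
    + apply is_RInt_pq_integrand; try assumption; apply Hz.
    + apply HP; change (Rabs (arcsin_pq p q z - L) < eps).
      pose proof (Hle z ltac:(lra)).
      pose proof (arcsin_pq_expanding p q a z Hp Hq ltac:(lra) ltac:(lra)).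
      pose proof (cond_pos eps).
      apply Rabs_def1; lra.
Qed.

(** * The case p = 6/5, q = 3: cube roots and the parametrization by u *)

Lemma cbrt_pow_3 (x : R) : 0 <= x -> rpow x (1 / 3) ^ 3 = x.
Proof.
  intros Hx; rewrite <- (rpow_mult_pow x (1 / 3) 2).
  replace (INR 3 * (1 / 3)) with (INR 1) by (simpl; field).
  rewrite rpow_pow by exact Hx; ring.
Qed.

Lemma cbrt_of_pow_3 (x : R) : 0 <= x -> rpow (x ^ 3) (1 / 3) = x.
Proof.
  intros Hx; rewrite <- rpow_pow, rpow_mult by exact Hx.
  replace (INR 3 * (1 / 3)) with (INR 1) by (simpl; field).
  rewrite rpow_pow by exact Hx; ring.
Qed.

Lemma rpow_3 (x : R) : 0 <= x -> rpow x 3 = x ^ 3.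
Proof.
  intros Hx; rewrite <- (rpow_pow x 2) by exact Hx; f_equal; simpl; ring.
Qed.

Lemma rpow_2_3 (x : R) : rpow x (2 / 3) = rpow x (1 / 3) ^ 2.
Proof. rewrite <- (rpow_mult_pow x (1 / 3) 1); f_equal; simpl; field. Qed.

(** Here 1/p = 5/6, and 2 * 5/6 = 5/3. It applies because 1 - s^3 is a perfect square for both s =
    [sin_of u] and s = [double_sin_of u]. *)
Lemma rpow_sqr_5_6 (x : R) :
  0 <= x -> rpow (x ^ 2) (1 / (6 / 5)) = rpow x (1 / 3) ^ 5.
Proof.
  intros Hx; rewrite <- (rpow_pow x 1), rpow_mult by exact Hx.
  rewrite <- (rpow_mult_pow x (1 / 3) 4); f_equal; simpl; field.
Qed.

(* In what follows [u] stands for cos(x)^(3/5). *)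
Definition sin_of (u : R) : R := rpow (1 - u ^ 2) (1 / 3).

Definition quartic (u : R) : R := 1 + 24 * u + 18 * u ^ 2 - 27 * u ^ 4.

(** This is F, with [quartic] as D. The factor [rpow u (1 / 3)] is cos(x)^(1/5), because cos(x) =
    u^(5/3). *)
Definition double_sin_of (u : R) : R :=
  4 * rpow u (1 / 3) * (1 + 3 * u) * rpow (1 - u) (1 / 3)
    / rpow (quartic u) (2 / 3).

(** One has D = 1 + 15u + 9u(1 - u^3) + 18u^2(1 - u^2), a sum of nonnegative terms and 1. *)
Lemma quartic_gt_0 (u : R) : 0 <= u <= 1 -> 0 < quartic u.
Proof.
  intros Hu; unfold quartic.
  assert (0 <= 1 - u ^ 3)
    by (pose proof (pow_incr u 1 3 Hu); rewrite pow1 in *; lra).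
  assert (0 <= 1 - u ^ 2) by nra.
  pose proof (Rmult_le_pos u (1 - u ^ 3) ltac:(lra) ltac:(lra)).
  pose proof (Rmult_le_pos (u ^ 2) (1 - u ^ 2)
    ltac:(apply pow2_ge_0) ltac:(lra)).
  nra.
Qed.

Lemma continuous_sin_of (u : R) : continuous sin_of u.
Proof.
  apply (continuous_comp (fun u => 1 - u ^ 2) (fun v => rpow v (1 / 3))).
  - apply (ex_derive_continuous (fun u : R => 1 - u ^ 2)); auto_derive; exact I.
  - apply continuous_rpow; lra.
Qed.

Lemma continuous_double_sin_of (u : R) :
  0 <= u <= 1 -> continuous double_sin_of u.
Proof.
  intros Hu; pose proof (quartic_gt_0 u Hu) as HD.
  apply (continuous_mult
    (fun u => 4 * rpow u (1 / 3) * (1 + 3 * u) * rpow (1 - u) (1 / 3))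
    (fun u => / rpow (quartic u) (2 / 3))).
  - apply (continuous_mult (fun u => 4 * rpow u (1 / 3) * (1 + 3 * u))
      (fun u => rpow (1 - u) (1 / 3))).
    + apply (continuous_mult (fun u => 4 * rpow u (1 / 3))
        (fun u => 1 + 3 * u)).
      * apply (continuous_mult (fun _ => 4) (fun u => rpow u (1 / 3))).
        -- apply continuous_const.
        -- apply continuous_rpow; lra.
      * apply (ex_derive_continuous (fun u : R => 1 + 3 * u)).
        auto_derive; exact I.
    + apply (continuous_comp (fun u => 1 - u) (fun v => rpow v (1 / 3))).
      * apply (ex_derive_continuous (fun u : R => 1 - u)).
        auto_derive; exact I.
      * apply continuous_rpow; lra.
  - apply (continuous_Rinv_comp (fun u => rpow (quartic u) (2 / 3))).
    + apply (continuous_comp quartic (fun v => rpow v (2 / 3))).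
      * apply (ex_derive_continuous quartic).
        unfold quartic; auto_derive; exact I.
      * apply continuous_rpow; lra.
    + apply Rgt_not_eq, rpow_gt_0, HD.
Qed.

Lemma one_minus_sin_of_cube (u : R) :
  0 <= u <= 1 -> 1 - rpow (sin_of u) 3 = u ^ 2.
Proof.
  intros Hu; unfold sin_of; rewrite rpow_3 by apply rpow_ge_0.
  rewrite cbrt_pow_3; [ring | nra].
Qed.

Lemma double_sin_of_ge_0 (u : R) : 0 <= u <= 1 -> 0 <= double_sin_of u.
Proof.
  intros Hu; unfold double_sin_of.
  apply Rdiv_le_0_compat; [ | apply rpow_gt_0, quartic_gt_0, Hu].
  apply Rmult_le_pos; [ | apply rpow_ge_0].
  apply Rmult_le_pos; [ | lra].
  apply Rmult_le_pos; [lra | apply rpow_ge_0].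
Qed.

Lemma double_sin_of_cube (u : R) :
  0 <= u <= 1 ->
  double_sin_of u ^ 3 = 64 * u * (1 + 3 * u) ^ 3 * (1 - u) / quartic u ^ 2.
Proof.
  intros Hu; pose proof (quartic_gt_0 u Hu) as HD.
  pose proof (rpow_gt_0 _ (1 / 3) HD) as He.
  unfold double_sin_of; rewrite rpow_2_3.
  rewrite <- (cbrt_pow_3 u) at 5 by lra.
  rewrite <- (cbrt_pow_3 (1 - u)) at 2 by lra.
  rewrite <- (cbrt_pow_3 (quartic u)) at 2 by lra.
  field; lra.
Qed.

(** This rests on the polynomial identity D^2 - 64u(1 + 3u)^3(1 - u) = (3u - 1)^6 (1 + u)^2. *)
Lemma one_minus_double_sin_of_cube (u : R) :
  0 <= u <= 1 ->
  1 - rpow (double_sin_of u) 3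
  = ((3 * u - 1) ^ 3 * (1 + u) / quartic u) ^ 2.
Proof.
  intros Hu; pose proof (quartic_gt_0 u Hu) as HD.
  rewrite rpow_3 by (apply double_sin_of_ge_0, Hu).
  rewrite double_sin_of_cube by exact Hu.
  unfold quartic in *; field; lra.
Qed.

(** For u > 1/3 the square equal to 1 - F^3 is strictly positive, which excludes F >= 1. *)
Lemma double_sin_of_lt_1 (u : R) : 1 / 3 < u <= 1 -> double_sin_of u < 1.
Proof.
  intros Hu; pose proof (quartic_gt_0 u ltac:(lra)) as HD.
  pose proof (one_minus_double_sin_of_cube u ltac:(lra)) as E.
  pose proof (double_sin_of_ge_0 u ltac:(lra)) as H0.
  rewrite rpow_3 in E by exact H0.
  destruct (Rlt_le_dec (double_sin_of u) 1) as [H | H]; [exact H | exfalso].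
  pose proof (pow_R1_Rle _ 3 H).
  assert (0 < ((3 * u - 1) ^ 3 * (1 + u) / quartic u) ^ 2); [ | lra].
  apply pow_lt, Rdiv_lt_0_compat; [ | exact HD].
  apply Rmult_lt_0_compat; [apply pow_lt; lra | lra].
Qed.

Lemma double_sin_of_third : double_sin_of (1 / 3) = 1.
Proof.
  pose proof (quartic_gt_0 (1 / 3) ltac:(lra)) as HD.
  pose proof (double_sin_of_ge_0 (1 / 3) ltac:(lra)) as H0.
  rewrite <- (cbrt_of_pow_3 (double_sin_of (1 / 3))) by exact H0.
  rewrite double_sin_of_cube by lra.
  (* Here D = 32/3, and numerator and D^2 both equal 1024/9. *)
  replace (64 * (1 / 3) * (1 + 3 * (1 / 3)) ^ 3 * (1 - 1 / 3)
           / quartic (1 / 3) ^ 2) with (1 ^ 3).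
  - apply cbrt_of_pow_3; lra.
  - unfold quartic in *; field.
Qed.

Lemma double_sin_of_1 : double_sin_of 1 = 0.
Proof.
  unfold double_sin_of; rewrite (rpow_nonpos_base (1 - 1)) by lra.
  unfold Rdiv; ring.
Qed.

Lemma sin_of_1 : sin_of 1 = 0.
Proof. apply rpow_nonpos_base; lra. Qed.

Lemma sin_of_bounds (u : R) : 0 < u -> 0 <= sin_of u < 1.
Proof.
  intros Hu; split; [apply rpow_ge_0 | apply rpow_lt_1; nra].
Qed.

Lemma pq_integrand_sin_of (u : R) :
  0 <= u <= 1 -> pq_integrand (6/5) 3 (sin_of u) = / rpow u (1 / 3) ^ 5.
Proof.
  intros Hu; unfold pq_integrand.
  rewrite one_minus_sin_of_cube, rpow_sqr_5_6 by lra; reflexivity.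
Qed.

Lemma pq_integrand_double_sin_of (u : R) :
  1 / 3 <= u <= 1 ->
  pq_integrand (6/5) 3 (double_sin_of u)
  = / ((3 * u - 1) * rpow (1 + u) (1 / 3) / rpow (quartic u) (1 / 3)) ^ 5.
Proof.
  intros Hu; pose proof (quartic_gt_0 u ltac:(lra)) as HD.
  pose proof (rpow_gt_0 _ (1 / 3) HD) as He.
  pose proof (rpow_ge_0 (1 + u) (1 / 3)) as Hc.
  unfold pq_integrand; rewrite one_minus_double_sin_of_cube by lra.
  rewrite <- (cbrt_pow_3 (1 + u)) at 1 by lra.
  rewrite <- (cbrt_pow_3 (quartic u)) at 1 by lra.
  (* Call this quantity w. Then 1 - F^3 = (w^3)^2, so the integrand is 1 / w^5. Nonnegativity of w
     is where u >= 1/3 enters. *)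
  assert (Hw : 0 <= (3 * u - 1) * rpow (1 + u) (1 / 3)
                    / rpow (quartic u) (1 / 3)).
  { apply Rdiv_le_0_compat; [apply Rmult_le_pos; lra | exact He]. }
  replace ((3 * u - 1) ^ 3 * rpow (1 + u) (1 / 3) ^ 3
           / rpow (quartic u) (1 / 3) ^ 3)
    with (((3 * u - 1) * rpow (1 + u) (1 / 3) / rpow (quartic u) (1 / 3)) ^ 3)
    by (field; lra).
  rewrite rpow_sqr_5_6, cbrt_of_pow_3 by (try apply pow_le; exact Hw).
  reflexivity.
Qed.

(** * Logarithmic derivatives, and the derivative of the duplication identity *)

(** The derivative is stated as the value times a logarithmic derivative, so that products and
    quotients only add or subtract rational terms and the cube roots stay factored out. *)
Lemma is_derive_rpow_comp (f : R -> R) (a x df : R) :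
  is_derive f x df -> 0 < f x ->
  is_derive (fun t => rpow (f t) a) x (rpow (f x) a * (a * df / f x)).
Proof.
  intros Hf Hx.
  replace (rpow (f x) a * (a * df / f x))
    with (df * (a * rpow (f x) a / f x)) by (field; lra).
  apply (is_derive_comp (fun v => rpow v a) f); [ | exact Hf].
  apply is_derive_rpow, Hx.
Qed.

Lemma is_derive_sin_of (u : R) :
  0 < u < 1 ->
  is_derive sin_of u (sin_of u * (1 / 3 * - (2 * u) / (1 - u ^ 2))).
Proof.
  intros Hu; apply (is_derive_rpow_comp (fun u => 1 - u ^ 2)); [ | nra].
  auto_derive; [exact I | ring].
Qed.

Lemma is_derive_mult_log (f g : R -> R) (x lf lg : R) :
  is_derive f x (f x * lf) -> is_derive g x (g x * lg) ->
  is_derive (fun t => f t * g t) x (f x * g x * (lf + lg)).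
Proof.
  intros Hf Hg.
  replace (f x * g x * (lf + lg))
    with (f x * lf * g x + f x * (g x * lg)) by ring.
  apply (is_derive_mult f g); [assumption.. | exact Rmult_comm].
Qed.

Lemma is_derive_div_log (f g : R -> R) (x lf lg : R) :
  is_derive f x (f x * lf) -> is_derive g x (g x * lg) -> g x <> 0 ->
  is_derive (fun t => f t / g t) x (f x / g x * (lf - lg)).
Proof.
  intros Hf Hg H0.
  replace (f x / g x * (lf - lg))
    with ((f x * lf * g x - f x * (g x * lg)) / g x ^ 2)
    by (field; exact H0).
  apply (is_derive_div f g); assumption.
Qed.

Lemma is_derive_double_sin_of (u : R) :
  0 < u < 1 ->
  is_derive double_sin_of u
    (double_sin_of u * (1 / 3 * 1 / u + 3 / (1 + 3 * u)
       + 1 / 3 * (- (1)) / (1 - u)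
       - 2 / 3 * (24 + 36 * u - 108 * u ^ 3) / quartic u)).
Proof.
  intros Hu; pose proof (quartic_gt_0 u ltac:(lra)) as HD.
  apply (is_derive_div_log
    (fun u => 4 * rpow u (1 / 3) * (1 + 3 * u) * rpow (1 - u) (1 / 3))
    (fun u => rpow (quartic u) (2 / 3))).
  - apply (is_derive_mult_log (fun u => 4 * rpow u (1 / 3) * (1 + 3 * u))
      (fun u => rpow (1 - u) (1 / 3))).
    + apply (is_derive_mult_log (fun u => 4 * rpow u (1 / 3))
        (fun u => 1 + 3 * u)).
      * rewrite Rmult_assoc.
        apply (is_derive_scal (fun u => rpow u (1 / 3))).
        apply (is_derive_rpow_comp (fun u => u));
          [apply is_derive_Reals, derivable_pt_lim_id | lra].
      * auto_derive; [exact I | field; lra].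
    + apply (is_derive_rpow_comp (fun u => 1 - u)); [ | lra].
      auto_derive; [exact I | ring].
  - apply is_derive_rpow_comp; [ | exact HD].
    unfold quartic; auto_derive; [exact I | ring].
  - apply Rgt_not_eq, rpow_gt_0, HD.
Qed.

(** By the chain rule both terms are rational functions of u times cube roots. After a common
    radical factor is extracted, a rational identity remains. *)
Lemma is_derive_arcsin_double_sin_of (u : R) :
  1 / 3 < u < 1 ->
  is_derive (fun v => arcsin_pq (6/5) 3 (double_sin_of v)
                      - 2 * arcsin_pq (6/5) 3 (sin_of v)) u 0.
Proof.
  intros Hu; pose proof (quartic_gt_0 u ltac:(lra)) as HD.
  pose proof (is_derive_comp (arcsin_pq (6/5) 3) double_sin_of u _ _
    (is_derive_arcsin_pq (6/5) 3 _ ltac:(lra) ltac:(lra)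
      (double_sin_of_lt_1 u ltac:(lra)))
    (is_derive_double_sin_of u ltac:(lra))) as H2.
  pose proof (is_derive_comp (arcsin_pq (6/5) 3) sin_of u _ _
    (is_derive_arcsin_pq (6/5) 3 _ ltac:(lra) ltac:(lra)
      (proj2 (sin_of_bounds u ltac:(lra))))
    (is_derive_sin_of u ltac:(lra))) as H1.
  pose proof (is_derive_minus _ _ _ _ _ H2 (is_derive_scal _ _ 2 _ H1)) as H.
  match type of H with is_derive _ _ ?l => replace 0 with l end; [exact H | ].
  clear H H1 H2.
  rewrite pq_integrand_double_sin_of, pq_integrand_sin_of by lra.
  change (double_sin_of u * (1 / 3 * 1 / u + 3 / (1 + 3 * u)
       + 1 / 3 * (- (1)) / (1 - u)
       - 2 / 3 * (24 + 36 * u - 108 * u ^ 3) / quartic u)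
    * / ((3 * u - 1) * rpow (1 + u) (1 / 3) / rpow (quartic u) (1 / 3)) ^ 5
    + - (2 * (sin_of u * (1 / 3 * - (2 * u) / (1 - u ^ 2))
              * / rpow u (1 / 3) ^ 5)) = 0).
  unfold double_sin_of, sin_of; rewrite rpow_2_3.
  (* Splitting the cube root of 1 - u^2 exposes the factor (1 - u)^(1/3), which F contains as
     well. *)
  replace (1 - u ^ 2) with ((1 - u) * (1 + u)) by ring.
  rewrite rpow_mult_base by lra.
  pose proof (rpow_gt_0 u (1 / 3) ltac:(lra)) as Ha.
  pose proof (rpow_gt_0 (1 - u) (1 / 3) ltac:(lra)) as Hb.
  pose proof (rpow_gt_0 (1 + u) (1 / 3) ltac:(lra)) as Hc.
  pose proof (rpow_gt_0 (quartic u) (1 / 3) HD) as He.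
  pose proof (cbrt_pow_3 u ltac:(lra)) as Ea.
  pose proof (cbrt_pow_3 (1 + u) ltac:(lra)) as Ec.
  pose proof (cbrt_pow_3 (quartic u) ltac:(lra)) as Ee.
  set (a := rpow u (1 / 3)) in *; set (b := rpow (1 - u) (1 / 3)) in *.
  set (c := rpow (1 + u) (1 / 3)) in *.
  set (e := rpow (quartic u) (1 / 3)) in *.
  (* Only the cubes of [a], [c] and [e] are rational in [u]. *)
  transitivity (4 * a * b / c ^ 5 *
    ((1 + 3 * u) * (1 / 3 * 1 / u + 3 / (1 + 3 * u)
       + 1 / 3 * (- (1)) / (1 - u)
       - 2 / 3 * (24 + 36 * u - 108 * u ^ 3) / quartic u)
       * e ^ 3 / (3 * u - 1) ^ 5
     + (c ^ 3) ^ 2 * u / (3 * (a ^ 3) ^ 2 * (1 - u) * (1 + u)))).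
  - field; repeat split; lra.
  - rewrite Ea, Ec, Ee.
    replace ((1 + 3 * u) * (1 / 3 * 1 / u + 3 / (1 + 3 * u)
       + 1 / 3 * (- (1)) / (1 - u)
       - 2 / 3 * (24 + 36 * u - 108 * u ^ 3) / quartic u)
       * quartic u / (3 * u - 1) ^ 5
     + (1 + u) ^ 2 * u / (3 * u ^ 2 * (1 - u) * (1 + u))) with 0; [ring | ].
    unfold quartic in *; field; repeat split; lra.
Qed.

(** * The duplication identity for [arcsin_pq] and the value of pi *)

Lemma continuous_arcsin_sin_of (u : R) :
  0 < u -> continuous (fun v => arcsin_pq (6/5) 3 (sin_of v)) u.
Proof.
  intros Hu; apply (continuous_comp sin_of (arcsin_pq (6/5) 3)).
  - apply continuous_sin_of.
  - apply continuous_arcsin_pq; try lra; apply sin_of_bounds, Hu.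
Qed.

(** The difference of the two sides has zero derivative inside [u, 1], is continuous up to the
    endpoints, and vanishes at 1. *)
Lemma arcsin_double_sin_of (u : R) :
  1 / 3 < u <= 1 ->
  arcsin_pq (6/5) 3 (double_sin_of u) = 2 * arcsin_pq (6/5) 3 (sin_of u).
Proof.
  intros Hu.
  destruct (MVT_gen (fun v => arcsin_pq (6/5) 3 (double_sin_of v)
                      - 2 * arcsin_pq (6/5) 3 (sin_of v)) u 1 (fun _ => 0))
    as [c [_ E]]; rewrite ?Rmin_left, ?Rmax_right in * by lra.
  - intros v Hv; apply is_derive_arcsin_double_sin_of; lra.
  - intros v Hv; apply continuity_pt_filterlim.
    apply (continuous_minus (fun v => arcsin_pq (6/5) 3 (double_sin_of v))
             (fun v => 2 * arcsin_pq (6/5) 3 (sin_of v))).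
    + apply (continuous_comp double_sin_of (arcsin_pq (6/5) 3)).
      * apply continuous_double_sin_of; lra.
      * apply continuous_arcsin_pq; try lra; apply double_sin_of_lt_1; lra.
    + apply (continuous_scal_r 2 (fun v => arcsin_pq (6/5) 3 (sin_of v))).
      apply continuous_arcsin_sin_of; lra.
  - rewrite double_sin_of_1, sin_of_1, (arcsin_pq_nonpos _ _ 0) in E by lra.
    lra.
Qed.

(** Since F = 1 at u = 1/3, the duplication identity is available only to the right of 1/3. Letting
    u tend to 1/3 shows that the supremum of [arcsin_pq] on [0, 1) is 2L. *)
Lemma pi_6_5_3 : pi_pq (6/5) 3 = 4 * arcsin_pq (6/5) 3 (sin_of (1 / 3)).
Proof.
  set (L := arcsin_pq (6/5) 3 (sin_of (1 / 3))).
  replace (4 * L) with (2 * (2 * L)) by ring.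
  assert (Hnear : forall d : posreal,
            exists u, 1 / 3 < u < 1 /\ u - 1 / 3 < d).
  { intros d; pose proof (cond_pos d).
    pose proof (Rmin_l (1 / 3) (d / 2)); pose proof (Rmin_r (1 / 3) (d / 2)).
    assert (0 < Rmin (1 / 3) (d / 2)) by (apply Rmin_pos; lra).
    exists (1 / 3 + Rmin (1 / 3) (d / 2)); lra. }
  apply pi_pq_sup; try lra.
  - intros y Hy.
    (* For u close to 1/3, F(u) exceeds y, so [arcsin_pq] at y is at most 2 [arcsin_pq] at
       [sin_of u]. This is at most 2L because [sin_of] decreases. *)
    pose proof (continuous_double_sin_of (1 / 3) ltac:(lra)) as Hc.
    unfold continuous in Hc; rewrite double_sin_of_third in Hc.
    destruct (proj1 (filterlim_locally _ _) Hc (mkposreal (1 - y) ltac:(lra)))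
      as [d Hd].
    destruct (Hnear d) as [u [Hu Hud]].
    specialize (Hd u
      ltac:(apply Rabs_def1; unfold minus, plus, opp; simpl; lra)).
    change (Rabs (double_sin_of u - 1) < 1 - y) in Hd.
    apply Rabs_def2 in Hd.
    pose proof (arcsin_pq_expanding (6/5) 3 y (double_sin_of u)
      ltac:(lra) ltac:(lra) ltac:(lra) (double_sin_of_lt_1 u ltac:(lra))).
    rewrite arcsin_double_sin_of in * by lra.
    assert (sin_of u <= sin_of (1 / 3)).
    { unfold sin_of; rewrite !rpow_pos_base by nra.
      apply Rle_Rpower_l; [lra | nra]. }
    pose proof (arcsin_pq_expanding (6/5) 3 (sin_of u) (sin_of (1 / 3))
      ltac:(lra) ltac:(lra) ltac:(lra)
      (proj2 (sin_of_bounds (1 / 3) ltac:(lra)))) as HL.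
    fold L in HL; lra.
  - intros eps.
    pose proof (continuous_arcsin_sin_of (1 / 3) ltac:(lra)) as Hc.
    (* The tolerance is halved because the identity doubles the error. *)
    destruct (proj1 (filterlim_locally _ _) Hc (pos_div_2 eps)) as [d Hd].
    destruct (Hnear d) as [u [Hu Hud]].
    specialize (Hd u
      ltac:(apply Rabs_def1; unfold minus, plus, opp; simpl; lra)).
    change (Rabs (arcsin_pq (6/5) 3 (sin_of u) - L) < eps / 2) in Hd.
    apply Rabs_def2 in Hd.
    exists (double_sin_of u); split.
    + split; [apply double_sin_of_ge_0; lra | apply double_sin_of_lt_1; lra].
    + rewrite arcsin_double_sin_of by lra; lra.
Qed.

(** * Returning from u to x *)

Lemma arcsin_sin_of_onto (x : R) :
  0 <= x < pi_pq (6/5) 3 / 4 ->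
  exists u, 1 / 3 < u <= 1 /\ arcsin_pq (6/5) 3 (sin_of u) = x.
Proof.
  rewrite pi_6_5_3; intros Hx.
  (* The sign change turns the decreasing function into an increasing one, as this form of the
     intermediate value theorem requires f(a) <= f(b). *)
  destruct (f_interv_is_interv
    (fun v => - arcsin_pq (6/5) 3 (sin_of v)) (1 / 3) 1 (- x))
    as [u [Hu E]].
  - lra.
  - rewrite sin_of_1, (arcsin_pq_nonpos _ _ 0) by lra; lra.
  - intros v Hv; apply continuity_pt_opp, continuity_pt_filterlim.
    apply continuous_arcsin_sin_of; lra.
  - exists u; split; [ | lra].
    (* The value u = 1/3 corresponds to x = pi/4, which the strict bound on x excludes. *)
    destruct (Req_dec u (1 / 3)) as [-> | Hne]; lra.
Qed.

Lemma cos_pq_arcsin_sin_of (u : R) :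
  0 < u <= 1 ->
  cos_pq (6/5) 3 (arcsin_pq (6/5) 3 (sin_of u)) = rpow u (5 / 3).
Proof.
  intros Hu; rewrite cos_pq_arcsin_pq by (try lra; apply sin_of_bounds; lra).
  rewrite one_minus_sin_of_cube by lra.
  rewrite <- (rpow_pow u 1), rpow_mult by lra; f_equal; simpl; field.
Qed.

Theorem theorem3p8 :
  forall x : R, 0 <= x < pi_pq (6/5) 3 / 4 ->
  sin_pq (6/5) 3 (2 * x) =
    4 * rpow (cos_pq (6/5) 3 x) (1/5)
      * (1 + 3 * rpow (cos_pq (6/5) 3 x) (3/5))
      * rpow (1 - rpow (cos_pq (6/5) 3 x) (3/5)) (1/3)
    / rpow (1 + 24 * rpow (cos_pq (6/5) 3 x) (3/5)
              + 18 * rpow (cos_pq (6/5) 3 x) (6/5)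
              - 27 * rpow (cos_pq (6/5) 3 x) (12/5)) (2/3).
Proof.
  intros x Hx; destruct (arcsin_sin_of_onto x Hx) as [u [Hu <-]].
  rewrite <- arcsin_double_sin_of by exact Hu.
  rewrite sin_pq_arcsin_pq; [ | lra.. | ].
  - rewrite cos_pq_arcsin_sin_of, !rpow_mult by lra.
    (* With cos(x) = u^(5/3), the powers 1/5, 3/5, 6/5 and 12/5 become u^(1/3), u, u^2 and u^4. The
       last three are written with [INR] so that [rpow_pow] applies. *)
    replace (5 / 3 * (1 / 5)) with (1 / 3) by field.
    replace (5 / 3 * (3 / 5)) with (INR 1) by (simpl; field).
    replace (5 / 3 * (6 / 5)) with (INR 2) by (simpl; field).
    replace (5 / 3 * (12 / 5)) with (INR 4) by (simpl; field).
    rewrite !rpow_pow, pow_1 by lra; reflexivity.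
  - split; [apply double_sin_of_ge_0; lra | apply double_sin_of_lt_1, Hu].
Qed.
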